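(* Let $n\geq l\geq 3$ be integers. If $G$ is an $n$-vertex unicyclic graph with girth $l$, then for every integer $k\geq 0$, $$n_k(US_n^l)\geq n_k(G)\geq n_k(UP_n^l).$$
   Context: A unicyclic graph is a connected graph containing exactly one cycle; its girth is the length of that cycle. A subtree of a graph $G$ is a subgraph of $G$ that is a tree (subtrees are distinguished as subgraphs); $n_k(G)$ is the number of subtrees of $G$ with exactly $k$ vertices, with the convention $n_0(G)=1$. $US_n^l$ is the graph obtained from the cycle $C_l$ by attaching $n-l$ pendent vertices to one vertex of the cycle. $UP_n^l$ is the graph obtained from $C_l$ by attaching a pendent path of length $n-l$ (i.e. with $n-l$ new vertices) to one vertex of the cycle. *)

(* Defs.v *)
From mathcomp Require Import all_boot.
Set Implicit Arguments. Unset Strict Implicit. Unset Printing Implicit Defensive.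

Section Graphs.
Variable T : finType.

Definition simple_graph (e : rel T) := symmetric e /\ irreflexive e.

Definition edges (e : rel T) : {set {set T}} :=
  [set [set x; y] | x in T, y in T & e x y].

Definition adjF (F : {set {set T}}) : rel T := fun u v => [set u; v] \in F.

Definition vertsF (F : {set {set T}}) : {set T} :=
  [set x | [exists f in F, x \in f]].

Definition connected_graph (e : rel T) := forall x y : T, connect e x y.

Definition is_subtree (e : rel T) (S : {set T}) (F : {set {set T}}) : bool :=
  [&& F \subset edges e,
      [forall f in F, f \subset S],
      S != set0,
      [forall x in S, forall y in S, connect (adjF F) x y] &
      #|F| == #|S| - 1].

Definition nsub (e : rel T) (k : nat) : nat :=
  if k == 0 then 1 else
  #|[set p : {set T} * {set {set T}} | is_subtree e p.1 p.2 && (#|p.1| == k)]|.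

Definition is_cycle (e : rel T) (C : {set {set T}}) : bool :=
  [&& C \subset edges e, C != set0,
      [forall x in vertsF C, #|[set f in C | x \in f]| == 2] &
      [forall x in vertsF C, forall y in vertsF C, connect (adjF C) x y]].

Definition unicyclic (e : rel T) :=
  connected_graph e /\ #|[set C | is_cycle e C]| = 1.

Definition girth_is (e : rel T) (l : nat) :=
  (exists2 C, is_cycle e C & #|C| = l) /\
  (forall C, is_cycle e C -> l <= #|C|).
End Graphs.

Definition cyc_adj (n l : nat) (x y : 'I_n) : bool :=
  [&& x < l, y < l & (y : nat) == (x.+1 %% l)].

Definition US_base (n l : nat) (x y : 'I_n) : bool :=
  cyc_adj l x y || ((x : nat) == 0) && (l <= y).
Definition US (n l : nat) : rel 'I_n := fun x y => US_base l x y || US_base l y x.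

(* UP_n^l : pendent path 0 - l - (l+1) - ... - (n-1) attached to vertex 0 *)
Definition UP_base (n l : nat) (x y : 'I_n) : bool :=
  cyc_adj l x y || (l <= y) && ((x : nat) == (if (y : nat) == l then 0 else y.-1)).
Definition UP (n l : nat) : rel 'I_n := fun x y => UP_base l x y || UP_base l y x.
Arguments US : clear implicits.
Arguments UP : clear implicits.

(* Main.v *)
Require Import Defs.
From mathcomp Require Import all_boot.
Set Implicit Arguments. Unset Strict Implicit. Unset Printing Implicit Defensive.

(* A unicyclic graph is obtained from its cycle by successively attaching
   pendent vertices.  Attaching v at u gives
     n_(k+1)(G + v) = n_(k+1)(G) + r_k(G, u) + [k = 0],
   where r_k(G, u) is the number of k-subtrees through u, so it suffices to
   bound r_k(G, u) for all u.  It satisfies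
     r_(k+1)(G + v, v) = r_k(G, u) + [k = 0],
     r_(k+1)(G + v, w) = r_(k+1)(G, w) + #{k-subtrees through u and w},
   the last term being at most r_k(G, w).  By induction r_k(G, u) is largest
   when everything hangs at u, and smallest when u is the end of a single
   pendent path.  On the cycle itself r_k = k for k <= l, since the k-subtrees
   are the arcs of k vertices. *)

(** * Subtrees of a graph and the effect of attaching a pendent vertex *)

Section Count.
Variable T : finType.
Implicit Types (V S A B : {set T}) (E F C : {set {set T}}) (p : {set T} * {set {set T}}).

Lemma adjF_sym F : symmetric (adjF F).
Proof. by move=> x y; rewrite /adjF setUC. Qed.

Lemma connect_adjF_sym F : connect_sym (adjF F).
Proof. exact: sym_connect_sym (adjF_sym F). Qed.

Lemma connect_adjFS F F' x y :
  F \subset F' -> connect (adjF F) x y -> connect (adjF F') x y.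
Proof.
move=> sFF'; apply: connect_sub => a b /(subsetP sFF') ab.
exact: connect1.
Qed.

Lemma connect_homo (e e' : rel T) (r : T -> T) x y :
  (forall a b, e a b -> connect e' (r a) (r b)) ->
  connect e x y -> connect e' (r x) (r y).
Proof.
move=> er /connectP[q pq ->]; elim: q x pq => //= a q IHq x /andP[xa aq].
exact: connect_trans (er _ _ xa) (IHq _ aq).
Qed.

Definition is_tree p : bool :=
  [&& [forall f in p.2, f \subset p.1], p.1 != set0,
      [forall x in p.1, forall y in p.1, connect (adjF p.2) x y] &
      #|p.2| == #|p.1| - 1].

Lemma is_treeP S F :
  reflect [/\ {in F, forall f : {set T}, f \subset S}, S != set0,
              {in S &, forall x y, connect (adjF F) x y} & #|F| = #|S| - 1]
          (is_tree (S, F)).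
Proof.
apply: (iffP and4P) => /=.
  case=> /forall_inP FS S0 /forall_inP cS /eqP cF; split=> // x y xS yS.
  by have /forall_inP := cS x xS; apply.
case=> FS S0 cS cF; split=> //; last exact/eqP.
- exact/forall_inP.
- by apply/forall_inP => x xS; apply/forall_inP => y yS; apply: cS.
Qed.

(** Graphs are pairs [V], [E] inside one fixed type, so that a pendent vertex can be attached
    without changing the type. [A] collects the vertices a subtree is required to contain. *)
Definition subtrees V E A k :=
  [set p : {set T} * {set {set T}} | [&& p.2 \subset E, p.1 \subset V, A \subset p.1,
    is_tree p & #|p.1| == k]].

Definition ntrees V E A k := #|subtrees V E A k|.

Lemma ntrees_nsub (e : rel T) k :
  nsub e k = if k == 0 then 1 else ntrees setT (edges e) set0 k.
Proof.
rewrite /nsub; case: eqP => // _; apply: eq_card => -[S F].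
by rewrite !inE /is_subtree /is_tree /= subsetT sub0set /= -!andbA.
Qed.

(** Trees are nonempty here, whereas n_0 = 1 by convention. This is why the pendent-vertex
    recursions carry a correction [k == 0]. *)
Lemma ntrees0 V E A : ntrees V E A 0 = 0.
Proof.
apply/eqP; rewrite cards_eq0; apply/eqP/setP => -[S F]; rewrite !inE /=.
by apply/and5P => -[_ _ _ /is_treeP[_ S0 _ _]]; rewrite cards_eq0 (negPf S0).
Qed.

Lemma ntreesS V E A B k : A \subset B -> ntrees V E B k <= ntrees V E A k.
Proof.
move=> sAB; apply/subset_leq_card/subsetP => -[S F]; rewrite !inE /=.
by case/and5P=> -> -> /(subset_trans sAB) -> -> ->.
Qed.

(** A tree inside [V] with at least [#|V|] vertices spans [V], so it passes through all of [B]
    anyway. *)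
Lemma ntrees_large V E A B k :
  #|V| <= k -> B \subset V -> ntrees V E (B :|: A) k = ntrees V E A k.
Proof.
move=> Vk BV; apply: eq_card => -[S F]; rewrite !inE /= subUset.
case sSV: (S \subset V); rewrite ?andbF //=; case: eqP; rewrite ?andbF //= => Sk.
have -> : S = V by apply/eqP; rewrite eqEcard sSV Sk.
by rewrite BV.
Qed.

Definition graph_on V E := {in E, forall f : {set T}, f \subset V}.

Section Leaf.
Variables (V : {set T}) (E : {set {set T}}) (u v : T).
Hypotheses (EV : graph_on V E) (uV : u \in V) (vV : v \notin V).

Let uv := [set u; v].

Lemma leaf_edge_notin : uv \notin E.
Proof.
by apply: contra vV => /EV /subsetP; apply; rewrite !inE eqxx orbT.
Qed.

Lemma leaf_edge_unique f : f \in uv |: E -> v \in f -> f = uv.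
Proof. by rewrite in_setU1 => /predU1P[//|/EV /subsetP fV /fV]; rewrite (negPf vV). Qed.

Lemma leaf_add S F : F \subset E -> S \subset V -> u \in S -> is_tree (S, F) ->
  is_tree (v |: S, uv |: F).
Proof.
move=> FE SV uS /is_treeP[FS S0 cS cF].
have vS : v \notin S by apply: contra vV => /(subsetP SV).
have uvF : uv \notin F by apply: contra leaf_edge_notin => /(subsetP FE).
have cu x : x \in v |: S -> connect (adjF (uv |: F)) u x.
  case/setU1P=> [-> | xS]; first by apply: connect1; rewrite /adjF setU11.
  by apply: connect_adjFS (subsetUr _ _) (cS _ _ uS xS).
apply/is_treeP; split.
- move=> f /setU1P[-> | /FS fS]; last exact: subset_trans fS (subsetUr _ _).
  by apply/subsetP=> x; rewrite !inE => /orP[] /eqP->; rewrite ?uS ?eqxx ?orbT.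
- by apply/set0Pn; exists v; rewrite setU11.
- move=> x y /cu ux /cu; apply: connect_trans; by rewrite connect_adjF_sym.
- rewrite !cardsU1 vS uvF cF; have : 0 < #|S| by rewrite card_gt0.
  by case: #|S| => // s _; rewrite subn1.
Qed.

Lemma leaf_remove S F : F \subset uv |: E -> S \subset v |: V -> uv \in F ->
  is_tree (S, F) ->
  [/\ F :\ uv \subset E, S :\ v \subset V, u \in S :\ v & is_tree (S :\ v, F :\ uv)].
Proof.
move=> FE SV uvF /is_treeP[FS S0 cS cF].
have [uS vS] : u \in S /\ v \in S.
  by have /subsetP uvS := FS _ uvF; rewrite !uvS // !inE eqxx ?orbT.
have neq_uv : u != v by apply: contraNneq vV => <-.
have uSv : u \in S :\ v by rewrite !inE neq_uv.
split=> //; first by rewrite subDset.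
  by rewrite subDset.
have vF f : f \in F :\ uv -> v \notin f.
  case/setD1P=> nf /(subsetP FE) /leaf_edge_unique fuv; apply: contra nf.
  by move=> /fuv/eqP.
apply/is_treeP; split.
- move=> f fF; rewrite subsetD1 vF // andbT; apply: FS.
  by case/setD1P: fF.
- by apply/set0Pn; exists u.
(* A path in [F] may pass through [v]. Folding [v] onto [u] collapses the edge [uv] and fixes every
   other edge, so it carries the path into [F :\ uv]. *)
- pose r z := if z == v then u else z.
  have rE z : z \in S :\ v -> r z = z by rewrite /r => /setD1P[/negPf->].
  move=> x y xS yS; rewrite -(rE x xS) -(rE y yS).
  apply: (@connect_homo (adjF F)); last first.
    by apply: cS; [case/setD1P: xS | case/setD1P: yS].
  move=> a b; rewrite /adjF => abF.
  have [ab_uv | nab] := eqVneq [set a; b] uv.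
    have [] : a \in uv /\ b \in uv by rewrite -ab_uv !inE !eqxx orbT.
    rewrite !inE /r => /orP[] /eqP-> /orP[] /eqP->;
    by rewrite ?eqxx ?(negPf neq_uv) connect0.
  have abF' : [set a; b] \in F :\ uv by rewrite !inE nab.
  have := vF _ abF'; rewrite !inE negb_or /r ![v == _]eq_sym.
  by case/andP=> /negPf-> /negPf->; apply: connect1.
- move: cF; rewrite (cardsD1 v S) (cardsD1 uv F) uvF vS !add1n subn1 /= => <-.
  by rewrite subn1.
Qed.

(** A path from [v] to another vertex of [S] starts with an edge at [v], and [uv] is the only
    one. *)
Lemma leaf_edge_in S F : F \subset uv |: E -> v \in S -> is_tree (S, F) ->
  #|S| != 1 -> uv \in F.
Proof.
move=> FE vS /is_treeP[FS S0 cS cF] S1.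
have /set0Pn[z] : S :\ v != set0.
  by apply: contra S1; rewrite -cards_eq0 (cardsD1 v S) vS => /eqP->.
case/setD1P=> nz zS; have /connectP[[|b q] /=] := cS _ _ vS zS.
  by move=> _ zv; rewrite zv eqxx in nz.
case/andP; rewrite /adjF => vbF _ _.
by rewrite -(leaf_edge_unique (subsetP FE _ vbF)) // !inE eqxx.
Qed.

(** Deleting [v] and [uv] matches the trees through [v] with the old trees through [u]. The only
    tree left over is the single vertex [v], which arises only for k = 0 and empty [A]. *)
Lemma ntrees_leaf A k : v \notin A ->
  ntrees (v |: V) (uv |: E) (v |: A) k.+1
  = ntrees V E (u |: A) k + (k == 0) && (A == set0).
Proof.
move=> vA.
pose phi (p : {set T} * {set {set T}}) := (v |: p.1, uv |: p.2).
have phi_inj : {in subtrees V E (u |: A) k &, injective phi}.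
  move=> [S F] [S' F']; rewrite !inE /= => /and5P[FE SV _ _ _] /and5P[FE' SV' _ _ _].
  have K S1 : S1 \subset V -> (v |: S1) :\ v = S1.
    by move=> /subsetP S1V; rewrite setU1K //; apply: contra vV => /S1V.
  have K' F1 : F1 \subset E -> (uv |: F1) :\ uv = F1.
    by move=> /subsetP F1E; rewrite setU1K //; apply: contra leaf_edge_notin => /F1E.
  by case=> eS eF; rewrite -(K S) // -(K' F) // eS eF K ?K'.
rewrite /ntrees -(card_in_imset phi_inj).
have cphi p : p \in phi @: subtrees V E (u |: A) k -> p.1 != [set v].
  case/imsetP=> -[S F]; rewrite inE subUset sub1set /=.
  case/and5P=> _ _ /andP[uS _] _ _ -> /=; apply: contraNneq vV => Sv.
  have : u \in v |: S by rewrite in_setU1 uS orbT.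
  by rewrite Sv inE => /eqP<-.
have sphi : phi @: subtrees V E (u |: A) k \subset
            subtrees (v |: V) (uv |: E) (v |: A) k.+1.
  apply/subsetP => _ /imsetP[[S F] + ->].
  rewrite !inE subUset sub1set /= => /and5P[FE SV /andP[uS AS] tSF /eqP Sk].
  rewrite /phi /= !setUS // leaf_add //= cardsU1 Sk.
  by rewrite (contra _ vV) // => /(subsetP SV).
have Ephi p : p \in subtrees (v |: V) (uv |: E) (v |: A) k.+1 -> uv \in p.2 ->
              p \in phi @: subtrees V E (u |: A) k.
  case: p => S F; rewrite inE subUset sub1set /=.
  case/and5P=> FE SV /andP[vS AS] tSF /eqP Sk uvF.
  have [FE' SV' uS' t'] := leaf_remove FE SV uvF tSF.
  apply/imsetP; exists (S :\ v, F :\ uv); last by rewrite /phi /= !setD1K.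
  rewrite inE /= FE' SV' t' subUset sub1set uS' subsetD1 AS vA /=.
  by move: Sk; rewrite (cardsD1 v S) vS add1n => -[->].
have Eempty S F : (S, F) \in subtrees (v |: V) (uv |: E) (v |: A) k.+1 ->
    uv \notin F -> [/\ k = 0, A = set0, S = [set v] & F = set0].
  rewrite inE subUset sub1set /= => /and5P[FE SV /andP[vS AS] tSF /eqP Sk] uvF.
  have S1 : #|S| = 1.
    by apply/eqP; apply: contraNT uvF; apply: leaf_edge_in FE vS tSF.
  have Sv : S = [set v].
    by apply/eqP; rewrite eq_sym eqEcard sub1set vS S1 cards1.
  split=> //; first by move: Sk; rewrite S1 => -[].
    apply/eqP; rewrite -subset0; apply/subsetP=> x xA; move: (subsetP AS x xA).
    by rewrite Sv inE => /eqP xv; rewrite -xv xA in vA.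
  by case/is_treeP: tSF => _ _ _ /eqP; rewrite S1 subnn cards_eq0 => /eqP.
have [/andP[/eqP k0 /eqP A0] | nk] := boolP ((k == 0) && (A == set0)).
  rewrite addn1.
  have <- : #|([set v], set0) |: phi @: subtrees V E (u |: A) k| =
            #|phi @: subtrees V E (u |: A) k|.+1.
    rewrite cardsU1 (contra (cphi _)) //= ?eqxx //.
  apply: eq_card; apply/subset_eqP/andP; split.
    apply/subsetP=> -[S F] SF; have [uvF | uvF] := boolP (uv \in F).
      by rewrite in_setU1 Ephi ?orbT.
    by have [_ _ -> ->] := Eempty _ _ SF uvF; rewrite setU11.
  rewrite subUset sphi andbT sub1set inE /= sub0set sub1set setU11.
  rewrite k0 A0 setU0 subxx cards1 eqxx andbT /=; apply/is_treeP; split.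
  - by move=> f; rewrite inE.
  - by apply/set0Pn; exists v; rewrite inE.
  - by move=> x y /set1P-> /set1P->; apply: connect0.
  - by rewrite cards0 cards1.
rewrite addn0; apply: eq_card; apply/subset_eqP; rewrite sphi andbT.
apply/subsetP=> -[S F] SF; apply: Ephi => //=; apply: contraNT nk => uvF.
by have [-> -> _ _] := Eempty _ _ SF uvF; rewrite !eqxx.
Qed.

(** Split by whether the tree contains [v]: a tree avoiding [v] cannot use [uv], so it already lives
    in the old graph. *)
Lemma ntrees_leafD A k : v \notin A ->
  ntrees (v |: V) (uv |: E) A k
  = ntrees V E A k + ntrees (v |: V) (uv |: E) (v |: A) k.
Proof.
move=> vA; rewrite /ntrees addnC.
rewrite -(cardsID [set p : {set T} * {set {set T}} | v \in p.1]); congr (_ + _).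
  apply: eq_card => -[S F]; rewrite !inE subUset sub1set /=.
  by case: (v \in S); rewrite /= ?andbT ?andbF.
apply: eq_card => -[S F]; rewrite !inE /=; apply/andP/idP.
  case=> vS /and5P[FE SV -> tSF ->]; rewrite tSF.
  have -> : S \subset V by rewrite -(setU1K vV) subsetD1 SV.
  rewrite !andbT; apply/subsetP=> f fF; have /setU1P[fuv | //] := subsetP FE f fF.
  case/is_treeP: tSF => /(_ f fF) /subsetP fS _ _ _; case/negP: vS.
  by apply: fS; rewrite fuv !inE eqxx orbT.
case/and5P=> FE SV -> -> ->; rewrite !(subset_trans _ (subsetUr _ _)) //; split=> //.
by apply: contra vV => /(subsetP SV).
Qed.
End Leaf.
End Count.

(** * The subtrees of a cycle are its arcs *)

Section Cycle.
Variables (T : finType) (c : seq T).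
Hypotheses (Uc : uniq c) (c3 : 2 < size c).

Let f := next c.

Definition cycle_edge x := [set x; next c x].
Definition cycle_edges := [set cycle_edge x | x in c].
Definition arc s k : {set T} := [set iter (val i) (next c) s | i : 'I_k].

Lemma next_inj : injective f.
Proof. exact: can_inj (prev_next Uc). Qed.

Lemma order_next x : x \in c -> order f x = size c.
Proof. exact: order_cycle (cycle_next Uc) Uc x. Qed.

Lemma iter_next_mem i x : (iter i f x \in c) = (x \in c).
Proof. by elim: i => //= i <-; rewrite mem_next. Qed.

Lemma iter_next_inj x i j : x \in c -> i < size c -> j < size c ->
  iter i f x = iter j f x -> i = j.
Proof.
move=> xc ic jc eij.
by rewrite -(@findex_iter _ f x i) ?order_next // eij findex_iter ?order_next.
Qed.

Lemma next_next_neq x : x \in c -> f (f x) != x.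
Proof. by move=> xc; apply/eqP => /(@iter_next_inj x 2 0 xc c3 (ltnW (ltnW c3))). Qed.

Lemma next_neq x : x \in c -> f x != x.
Proof. by move=> xc; apply/eqP => /(@iter_next_inj x 1 0 xc (ltnW c3) (ltnW (ltnW c3))). Qed.

(** On a cycle of length 2 both vertices would name the same edge; from length 3 on, [next] applied
    twice moves every vertex, which excludes this. *)
Lemma cycle_edge_inj : {in c &, injective cycle_edge}.
Proof.
move=> x y xc yc exy.
have : x \in cycle_edge y by rewrite -exy !inE eqxx.
have : y \in cycle_edge x by rewrite exy !inE eqxx.
rewrite !inE => /orP[/eqP // | /eqP yE] /orP[/eqP // | /eqP xE].
by have := next_next_neq xc; rewrite /f -yE -xE eqxx.
Qed.

Lemma card_cycle_edges : #|cycle_edges| = size c.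
Proof. by rewrite card_in_imset; [apply/card_uniqP | apply: cycle_edge_inj]. Qed.

Lemma arcP s k x : reflect (exists2 i, i < k & x = iter i f s) (x \in arc s k).
Proof.
apply: (iffP imsetP) => [[i _ ->] | [i ik ->]]; first by exists i.
by exists (Ordinal ik).
Qed.

Lemma arc_sub s k : s \in c -> {subset arc s k <= c}.
Proof. by move=> sc _ /arcP[i _ ->]; rewrite iter_next_mem. Qed.

Lemma card_arc s k : s \in c -> k <= size c -> #|arc s k| = k.
Proof.
move=> sc kc; rewrite card_imset ?card_ord // => i j eij; apply/val_inj.
by apply: iter_next_inj sc _ _ eij; apply: leq_trans (ltn_ord _) kc.
Qed.

Lemma mem_cycle_edge_arc s k x : s \in c -> x \in c ->
  (cycle_edge x \in cycle_edge @: arc s k) = (x \in arc s k).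
Proof.
move=> sc xc; apply/imsetP/idP => [[y ya] | xa]; last by exists x.
by move/cycle_edge_inj => -> //; apply: arc_sub ya.
Qed.

(** The last vertex of the arc emits no edge, hence [k.-1]. When k is the full length, the vertex
    set is the whole cycle for every start, and only the omitted edge depends on [s]. *)
Definition arc_tree k s := (arc s k, cycle_edge @: arc s k.-1).

Lemma arc_tree_is_tree k s : s \in c -> 0 < k <= size c -> is_tree (arc_tree k s).
Proof.
move=> sc /andP[k0 kc]; apply/is_treeP.
have k1c : k.-1 <= size c by apply: leq_trans (leq_pred k) kc.
split.
- move=> _ /imsetP[_ /arcP[i ik ->] ->]; rewrite -ltnS prednK // in ik.
  apply/subsetP => x; rewrite !inE => /orP[] /eqP->; apply/arcP.
    by exists i => //; apply: ltnW.
  by exists i.+1.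
- by apply/set0Pn; exists s; apply/arcP; exists 0.
- have cs x : x \in arc s k -> connect (adjF (cycle_edge @: arc s k.-1)) s x.
    case/arcP=> i; elim: i x => [|i IHi] x ik ->; first exact: connect0.
    apply: connect_trans (IHi _ (ltnW ik) erefl) (connect1 _).
    apply/imsetP; exists (iter i f s) => //; apply/arcP; exists i => //.
    by rewrite -ltnS prednK.
  move=> x y /cs sx /cs; apply: connect_trans; by rewrite connect_adjF_sym.
- rewrite card_in_imset ?card_arc // ?subn1 // => x y /(arc_sub sc) xc /(arc_sub sc).
  exact: cycle_edge_inj.
Qed.

Lemma arc_tree_inj k : 0 < k <= size c -> {in c &, injective (arc_tree k)}.
Proof.
move=> /andP[k0 kc] s s' sc s'c [eA eE].
have : s' \in arc s k by rewrite eA; apply/arcP; exists 0.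
case/arcP=> -[|i] // ik s'E.
have ic : iter i f s \in c by rewrite iter_next_mem.
(* The edge entering [s'] belongs to the first tree, hence to the second. There it would bring [s']
   back to itself after fewer than [size c] steps. *)
have : iter i f s \in arc s' k.-1.
  rewrite -mem_cycle_edge_arc // -eE mem_cycle_edge_arc //.
  by apply/arcP; exists i => //; rewrite -ltnS prednK.
case/arcP=> j jk iE; have jc : j.+1 < size c.
  by apply: leq_trans kc; rewrite -(prednK k0) ltnS.
have s'E' : iter 0 f s' = iter j.+1 f s' by rewrite /= -iE {1}s'E.
by have := iter_next_inj s'c (leq_trans k0 kc) jc s'E'.
Qed.

(* A tree (S, F) in the cycle misses exactly one edge entering S, since |F| = |S| - 1; its
   head s is the start of the arc.  Connectedness is not needed. *)
Lemma arc_tree_surj k (S : {set T}) (F : {set {set T}}) : 0 < k <= size c ->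
  F \subset cycle_edges -> {subset S <= c} -> is_tree (S, F) -> #|S| = k ->
  exists2 s, s \in c & (S, F) = arc_tree k s.
Proof.
move=> /andP[k0 kc] FC Sc /is_treeP[FS S0 _ cF] Sk.
(* [D] holds the tails of the edges of [F], and [f @: D] their heads; both have k - 1 elements. *)
pose D := [set x in c | cycle_edge x \in F].
have Dc : {subset D <= c} by move=> x; rewrite inE => /andP[].
have FD : F = cycle_edge @: D.
  apply/setP=> g; apply/idP/imsetP => [gF | [x + ->]]; last by rewrite inE => /andP[].
  have /imsetP[x xc gE] := subsetP FC _ gF.
  by exists x; rewrite // inE -gE gF andbT.
have cD : #|D| = k.-1.
  by rewrite -subn1 -Sk -cF FD card_in_imset // => x y /Dc xc /Dc; apply: cycle_edge_inj.
have DS x : x \in D -> (x \in S) && (f x \in S).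
  rewrite inE => /andP[_ /FS/subsetP xS]; apply/andP.
  by split; apply: xS; rewrite !inE eqxx ?orbT.
have sfD : f @: D \subset S by apply/subsetP => _ /imsetP[x /DS/andP[_ ?] ->].
have cfD : #|f @: D| = k.-1 by rewrite card_imset //; apply: next_inj.
have : #|S :\: f @: D| == 1.
  by rewrite cardsDS // cfD Sk -[X in X - _](prednK k0) subSnn.
case/cards1P=> s sE.
have sS : s \in S by have : s \in S :\: f @: D; [rewrite sE set11 | case/setDP].
have sfDn : s \notin f @: D by have : s \in S :\: f @: D; [rewrite sE set11 | case/setDP].
have sc := Sc _ sS.
exists s => //.
have Sf x : x \in S -> x != s -> x \in f @: D.
  by move=> xS; apply: contraR => xD; rewrite -in_set1 -sE inE xD.
(* [D] is closed under stepping back towards [s]: an element of [D] other than [s] lies in [S],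
   hence is the head of an edge of [F], whose tail is again in [D]. *)
have Ddown i j : j < size c -> iter j f s \in D -> i <= j -> iter i f s \in D.
  elim: j => [|j IHj] jc jD; first by rewrite leqn0 => /eqP->.
  rewrite leq_eqVlt => /predU1P[-> // | ]; apply: IHj; first exact: ltnW.
  have /andP[jS _] := DS _ jD.
  have : iter j.+1 f s \in f @: D.
    apply: Sf => //; apply/eqP => /(@iter_next_inj s j.+1 0 sc jc) H.
    by have /H := leq_trans k0 kc.
  by case/imsetP=> y yD /= /next_inj->.
have DA : D = arc s k.-1.
  apply/eqP; rewrite eq_sym eqEcard cD card_arc //; last by rewrite (leq_trans (leq_pred _)).
  rewrite leqnn andbT; apply/subsetP => _ /arcP[i ik ->].
  (* If the vertex i steps after [s] were not in [D], then [Ddown] would confine [D] to [arc s i],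
     forcing k - 1 <= i. *)
  apply: contraTT ik => iD; rewrite -leqNgt -cD.
  apply: leq_trans (_ : #|arc s i| <= i); last first.
    by rewrite -[X in _ <= X]card_ord leq_imset_card.
  apply/subset_leq_card/subsetP => x xD; have xc := Dc _ xD.
  have sx : fconnect f s x by rewrite (fconnect_cycle (cycle_next Uc)).
  apply/arcP; exists (findex f s x); last by rewrite iter_findex.
  rewrite ltnNge; apply: contra iD; apply: Ddown; last by rewrite iter_findex.
  by rewrite -(order_next sc) findex_max.
have SA : S = arc s k.
  apply/eqP; rewrite eqEcard Sk card_arc // leqnn andbT.
  apply/subsetP => x xS; have [-> | xs] := eqVneq x s; first by apply/arcP; exists 0.
  have /imsetP[y + ->] := Sf _ xS xs; rewrite DA => /arcP[i ik ->].
  by apply/arcP; exists i.+1; rewrite // -(prednK k0).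
by rewrite /arc_tree -SA -DA -FD.
Qed.

Lemma ntrees_cycle_arcs (A : {set T}) k : 0 < k <= size c ->
  ntrees [set x in c] cycle_edges A k = #|[set s in c | A \subset arc s k]|.
Proof.
move=> k0c; rewrite -(card_in_imset (f := arc_tree k)); last first.
  by move=> x y; rewrite !inE => /andP[xc _] /andP[yc _]; apply: arc_tree_inj.
apply: eq_card => -[S F]; rewrite inE; apply/and5P/imsetP => /=.
  case=> FC /subsetP SC AS tSF /eqP Sk.
  have Sc : {subset S <= c} by move=> x /SC; rewrite inE.
  have [s sc SFs] := arc_tree_surj k0c FC Sc tSF Sk.
  by exists s => //; rewrite inE sc /=; case: SFs => <-.
case=> s; rewrite inE => /andP[sc As] [-> ->].
split=> //; last by case/andP: k0c => _ kc; rewrite card_arc.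
- apply/subsetP=> _ /imsetP[x /(arc_sub sc) xc ->]; exact: imset_f.
- by apply/subsetP=> x /(arc_sub sc); rewrite inE.
- exact: arc_tree_is_tree.
Qed.

Lemma ntrees_cycle_large (A : {set T}) k : size c < k ->
  ntrees [set x in c] cycle_edges A k = 0.
Proof.
move=> ck; apply/eqP; rewrite cards_eq0; apply/eqP/setP=> -[S F]; rewrite !inE /=.
apply/and5P => -[_ /subset_leq_card + _ _ /eqP Sk].
by rewrite Sk cardsE (card_uniqP Uc) leqNgt ck.
Qed.

Lemma ntrees_cycle k :
  ntrees [set x in c] cycle_edges set0 k = if 0 < k <= size c then size c else 0.
Proof.
case: ifP => [k0c | ].
  rewrite ntrees_cycle_arcs // -(card_uniqP Uc) -cardsE; apply: eq_card => s.
  by rewrite !inE sub0set andbT.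
case: k => [|k] /=; first by rewrite ntrees0.
by move/negbT; rewrite -ltnNge; apply: ntrees_cycle_large.
Qed.

Lemma ntrees_cycle_vertex w k : w \in c ->
  ntrees [set x in c] cycle_edges [set w] k = if k <= size c then k else 0.
Proof.
move=> wc; case: leqP => [kc | ]; last exact: ntrees_cycle_large.
case: k kc => [|k] kc; first by rewrite ntrees0.
rewrite ntrees_cycle_arcs //.
have can_iter i : cancel (iter i f) (iter i (prev c)).
  by elim: i => // i IHi x; rewrite iterSr /= prev_next.
have can_iter' i : cancel (iter i (prev c)) (iter i f).
  by elim: i => // i IHi x; rewrite iterSr /= /f next_prev.
have iter_c i : iter i (prev c) w \in c.
  by elim: i => //= i IHi; rewrite mem_prev.
(* The arcs of k + 1 vertices through [w] are those starting at most k steps before [w]; these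
   starts are distinct because k + 1 <= [size c]. *)
transitivity #|[set iter (val i) (prev c) w | i : 'I_k.+1]|; last first.
  rewrite card_imset ?card_ord // => i j eij; apply/val_inj.
  apply: (@iter_next_inj (iter (val i) (prev c) w)) (iter_c _) _ _ _.
  1,2: exact: leq_trans (ltn_ord _) kc.
  by rewrite can_iter' eij can_iter'.
apply: eq_card => s; rewrite !inE sub1set; apply/andP/imsetP.
  by case=> sc /arcP[i ik ->]; exists (Ordinal ik) => //=; rewrite can_iter.
case=> i _ ->; split=> //; apply/arcP; exists (val i).
  exact: ltn_ord.
exact/esym/can_iter'.
Qed.
End Cycle.

(** * Growing connected graphs by pendent vertices; unicyclic graphs grow from their cycle *)

Section Growth.
Variable T : finType.
Implicit Types (V S A B : {set T}) (E F C : {set {set T}}).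

(* (V, E) arises from (V0, E0) by attaching m pendent vertices one after the other. *)
Inductive grown V0 E0 : nat -> {set T} -> {set {set T}} -> Prop :=
| grown0 : grown V0 E0 0 V0 E0
| grownS m V E u v : grown V0 E0 m V E -> u \in V -> v \notin V ->
    grown V0 E0 m.+1 (v |: V) ([set u; v] |: E).

Definition connected_on V E := {in V &, forall x y, connect (adjF E) x y}.

Lemma grown_on V0 E0 m V E : grown V0 E0 m V E -> graph_on V0 E0 -> graph_on V E.
Proof.
move=> G E0V; elim: G => // {}m {}V {}E u v _ EV uV vV f /setU1P[-> | /EV fV].
  by apply/subsetP=> x; rewrite !inE => /orP[] /eqP->; rewrite ?uV ?eqxx ?orbT.
exact: subset_trans fV (subsetUr _ _).
Qed.

Lemma grown_card V0 E0 m V E : grown V0 E0 m V E -> #|V| = #|V0| + m.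
Proof.
by elim=> [|{}m {}V {}E u v _ cV _ vV]; rewrite ?addn0 // cardsU1 vV cV addnS.
Qed.

Lemma grown_sub V0 E0 m V E : grown V0 E0 m V E -> V0 \subset V /\ E0 \subset E.
Proof.
elim=> // {}m {}V {}E u v _ [sV sE] _ _.
by split; [apply: subset_trans sV _ | apply: subset_trans sE _]; apply: subsetUr.
Qed.

Lemma grown_connected V0 E0 m V E :
  grown V0 E0 m V E -> connected_on V0 E0 -> connected_on V E.
Proof.
move=> G cV0; elim: G => // {}m {}V {}E u v _ cV uV vV.
have cu x : x \in v |: V -> connect (adjF ([set u; v] |: E)) u x.
  case/setU1P=> [-> | xV]; first by apply: connect1; rewrite /adjF setU11.
  by apply: connect_adjFS (subsetUr _ _) (cV _ _ uV xV).
move=> x y /cu ux /cu; apply: connect_trans; by rewrite connect_adjF_sym.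
Qed.

(** While a vertex is missing, connectedness gives an edge leaving [V], whose outer end is attached
    next. Started from one vertex this yields a spanning tree; it is also started from the cycle. *)
Lemma grown_spanning (e : rel T) V0 E0 : connected_graph e ->
  V0 != set0 -> E0 \subset edges e ->
  exists m E, grown V0 E0 m setT E /\ E \subset edges e.
Proof.
move=> ce /set0Pn[x0 x0V0] E0e.
have: exists m V E, [/\ grown V0 E0 m V E, E \subset edges e & #|~: V| = 0]; last first.
  case=> m [V [E [G Ee /eqP]]]; rewrite cards_eq0 => /eqP VT.
  by exists m, E; rewrite -(setCK V) VT setC0 in G.
have: exists m V E, [/\ grown V0 E0 m V E, E \subset edges e & #|~: V| <= #|~: V0|].
  by exists 0, V0, E0; split=> //; apply: grown0.
elim: #|~: V0| => [|n IHn] [m [V [E [G Ee Vn]]]].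
  by exists m, V, E; split=> //; apply/eqP; rewrite -leqn0.
apply: IHn; have [VT | /set0Pn[y]] := eqVneq (~: V) set0.
  by exists m, V, E; rewrite VT cards0.
rewrite inE => yV; have x0V : x0 \in V by have [/subsetP ->] := grown_sub G.
suff [u [v [uV vV euv]]] : exists u v, [/\ u \in V, v \notin V & e u v].
  exists m.+1, (v |: V), ([set u; v] |: E); split; first exact: grownS.
    by rewrite subUset Ee andbT sub1set; apply/imset2P; exists u v; rewrite ?inE.
  by move: Vn; rewrite setCU setIC -setDE (cardsD1 v (~: V)) inE vV.
(* Along a path from [x0] inside [V] to [y] outside, take the first edge that leaves [V]. *)
have /connectP[p] := ce x0 y; elim: p x0 x0V {x0V0} => [x0 x0V _ yx0 | z p IHp x0 x0V].
  by rewrite yx0 x0V in yV.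
case/andP=> x0z zp yE; have [zV | zV] := boolP (z \in V); first exact: IHp zV zp yE.
by exists x0, z.
Qed.

(** The vertex attached last lies on one edge only, while a cycle has two edges at each of its
    vertices. So a cycle avoids the last edge and already lies in the previous stage. *)
Lemma grown_acyclic (e : rel T) V0 m V E C :
  grown V0 set0 m V E -> is_cycle e C -> ~~ (C \subset E).
Proof.
elim=> [|{}m {}V {}E u v G IH uV vV] cC.
  by case/and4P: cC => _ C0 _ _; rewrite subset0.
apply: contra (IH cC) => sC; have EV : graph_on V E.
  by apply: grown_on G _ => f; rewrite inE.
have [uvC | uvC] := boolP ([set u; v] \in C); last first.
  apply/subsetP=> f fC; have /setU1P[fE | //] := subsetP sC f fC.
  by rewrite -fE fC in uvC.
case/and4P: cC => _ _ /forall_inP/(_ v) + _.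
have -> : v \in vertsF C.
  by rewrite inE; apply/exists_inP; exists [set u; v]; rewrite // !inE eqxx orbT.
move/(_ isT)/eqP => c2; have : [set f in C | v \in f] \subset [set [set u; v]].
  apply/subsetP=> f; rewrite !inE => /andP[fC vf]; apply/eqP.
  exact: (leaf_edge_unique EV vV (subsetP sC f fC) vf).
by move/subset_leq_card; rewrite c2 cards1.
Qed.

Lemma cycle_connected (c : seq T) : uniq c ->
  {in c &, forall x y, connect (adjF (cycle_edges c)) x y}.
Proof.
move=> Uc x y xc yc; have : fconnect (next c) x y by rewrite (fconnect_cycle (cycle_next Uc)).
case/connectP=> p; elim: p x xc => [|z p IHp] x xc /= => [_ ->|]; first exact: connect0.
case/andP=> /eqP<- zp yE; apply: connect_trans (IHp _ _ zp yE); last by rewrite mem_next.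
by apply: connect1; apply/imsetP; exists x.
Qed.

Lemma cycle_edges_is_cycle (e : rel T) (c : seq T) : uniq c -> 2 < size c ->
  cycle_edges c \subset edges e -> is_cycle e (cycle_edges c).
Proof.
move=> Uc c3 ce; have c0 : exists x, x \in c.
  by case: (c) c3 => // x ? _; exists x; rewrite inE eqxx.
have vc x : x \in vertsF (cycle_edges c) -> x \in c.
  rewrite inE => /exists_inP[_ /imsetP[y yc ->]]; rewrite !inE => /orP[] /eqP-> //.
  by rewrite mem_next.
apply/and4P; split=> //.
- by case: c0 => x xc; apply/set0Pn; exists (cycle_edge c x); apply: imset_f.
- apply/forall_inP=> x /vc xc.
  have -> : [set f in cycle_edges c | x \in f] = [set cycle_edge c x; cycle_edge c (prev c x)].
    apply/setP=> f; rewrite !inE; apply/andP/orP.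
      case=> /imsetP[y yc ->]; rewrite !inE => /orP[] /eqP->; first by left.
      by right; rewrite prev_next.
    case=> /eqP->; rewrite imset_f ?mem_prev // !inE ?eqxx //.
    by rewrite next_prev // eqxx orbT.
  rewrite cards2; case: (eqVneq (cycle_edge c x)) => // eqe.
  have xE : x = prev c x by apply: cycle_edge_inj Uc c3 _ _ _ _ eqe; rewrite ?mem_prev.
  by have /eqP[] := next_neq Uc c3 xc; rewrite [in LHS]xE next_prev.
- apply/forall_inP=> x /vc xc; apply/forall_inP=> y /vc yc.
  exact: cycle_connected.
Qed.

(** Make the path from [x] to [y] simple and close it with the edge xy. It has a third vertex
    because [x] and [y] are distinct and not joined in [E]. *)
Lemma close_cycle E x y : x != y -> [set x; y] \notin E -> connect (adjF E) x y ->
  exists2 c : seq T, uniq c && (2 < size c) &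
    [set x; y] \in cycle_edges c /\ cycle_edges c \subset [set x; y] |: E.
Proof.
move=> nxy xyE /connectP[p0 /shortenP[p xp Up _] yE].
exists (x :: p).
  rewrite Up; case: p xp Up yE => [|z [|? ?]] //=.
    by move=> _ _ yx; rewrite yx eqxx in nxy.
  by rewrite andbT => xz _ yz; rewrite yz -[_ \in E]/(adjF E x z) xz in xyE.
have nyx : next (x :: p) y = x.
  have -> : y = prev (x :: p) x.
    rewrite prev_nth mem_head /= memNindex; last by case/andP: Up.
    by rewrite (nth_last x (x :: p)) /= -yE.
  by rewrite next_prev.
have yp : y \in x :: p by rewrite yE mem_last.
split; first by apply/imsetP; exists y => //; rewrite /cycle_edge nyx setUC.
have cp : cycle (adjF ([set x; y] |: E)) (x :: p).
  rewrite /= rcons_path -yE /adjF [[set y; x]]setUC setU11 andbT.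
  by apply: sub_path xp => a b; rewrite /adjF => abE; rewrite !inE abE orbT.
by apply/subsetP=> _ /imsetP[z zp ->]; apply: next_cycle cp zp.
Qed.

Lemma grown_closes (e : rel T) V0 E0 m E f : simple_graph e ->
  connected_on V0 E0 -> grown V0 E0 m setT E -> E \subset edges e ->
  f \in edges e -> f \notin E ->
  exists2 c : seq T, uniq c && (2 < size c) &
    f \in cycle_edges c /\ is_cycle e (cycle_edges c).
Proof.
move=> [_ irr] cV0 G Ee fe fE.
have /imset2P[x y _] := fe; rewrite inE => /andP[_ exy] fxy; rewrite fxy in fe fE *.
have nxy : x != y by apply: contraTneq exy => ->; rewrite irr.
have := close_cycle nxy fE (grown_connected G cV0 (in_setT x) (in_setT y)).
case=> c /andP[Uc c3] [fc cE]; exists c; first by rewrite Uc.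
split=> //; apply: cycle_edges_is_cycle => //; apply: subset_trans cE _.
by rewrite subUset sub1set fe.
Qed.

Lemma unicyclic_grown (e : rel T) l (x0 : T) :
  simple_graph e -> unicyclic e -> girth_is e l ->
  exists c m, [/\ uniq c, 2 < size c, size c = l &
                  grown [set x in c] (cycle_edges c) m setT (edges e)].
Proof.
move=> se [ce /eqP/cards1P[C0 C0E]] [[C cC Cl] _].
have uniqC C' : is_cycle e C' -> C' = C.
  have CE D : is_cycle e D -> D = C0 by move=> cD; apply/set1P; rewrite -C0E inE.
  by move=> /CE->; rewrite (CE C).
(* A spanning tree has no cycle, so it misses an edge of C; closing that edge presents C
   as a cyclic sequence c, from which the whole graph is grown. *)
have cx0 : connected_on [set x0] set0 by move=> x y /set1P-> /set1P->; apply: connect0.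
have [] := @grown_spanning e [set x0] set0 ce; rewrite ?sub0set //.
  by apply/set0Pn; exists x0; rewrite inE.
move=> m1 [E1 [G1 E1e]].
have /subsetPn[f fC fE1] := grown_acyclic G1 cC.
have fe : f \in edges e by case/and4P: cC => /subsetP/(_ f fC).
have [c /andP[Uc c3] [_ cc]] := grown_closes se cx0 G1 E1e fe fE1.
have cE := uniqC _ cc.
have cconn : connected_on [set x in c] (cycle_edges c).
  by move=> x y; rewrite !inE; apply: cycle_connected.
have [] := @grown_spanning e [set x in c] (cycle_edges c) ce.
- by case: (c) c3 => // x c' _; apply/set0Pn; exists x; rewrite !inE eqxx.
- by case/and4P: cc.
move=> m [E [G Ee]]; exists c, m; split=> //; first by rewrite -card_cycle_edges ?cE.
(* A further edge would close a cycle; by uniqueness that cycle is [C], whose edges all lie in [E]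
   already. *)
suff -> : edges e = E by [].
apply/eqP; rewrite eqEsubset Ee andbT; apply/subsetP=> g ge; apply: contraT => gE.
have [c' _ [gc' /uniqC c'C]] := grown_closes se cconn G Ee ge gE.
by case/negP: gE; apply: (subsetP (proj2 (grown_sub G))); rewrite cE -c'C.
Qed.
End Growth.

(** * Bounds for all graphs grown from a cycle *)

Section Bounds.
Variable l : nat.

(* In US_(l+m)^l and UP_(l+m)^l respectively, [star_count m k] and [path_count m k] count the
   k-subtrees through the attachment vertex, resp. through the free end of the path. *)
Fixpoint star_count m k :=
  match m, k with
  | 0, _ => if k <= l then k else 0
  | m'.+1, 0 => 0
  | m'.+1, k'.+1 => star_count m' k'.+1 + star_count m' k'
  end.

Fixpoint path_count m k :=
  match m, k with
  | 0, _ => if k <= l then k else 0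
  | m'.+1, 0 => 0
  | m'.+1, k'.+1 => path_count m' k' + (k' == 0)
  end.

(** The number of all k-subtrees, where [g m' k'] counts the k'-subtrees through the vertex at which
    the next pendent vertex is attached. *)
Fixpoint total_count (g : nat -> nat -> nat) m k :=
  match m, k with
  | 0, _ => if 0 < k <= l then l else 0
  | m'.+1, 0 => 0
  | m'.+1, k'.+1 => total_count g m' k'.+1 + (g m' k' + (k' == 0))
  end.

Lemma star_count1 m : 0 < l -> 0 < star_count m 1.
Proof. by move=> l0; elim: m => [|m IHm] /=; [rewrite l0 | rewrite addn_gt0 IHm]. Qed.

(** [path_count m k] is 1 for 0 < k <= m, then k - m up to k = l + m, and 0 beyond. At k = l + m the
    claim would compare l with 0, hence the bound on k. *)
Lemma path_count_le m k : k < l + m -> path_count m.+1 k.+1 <= path_count m k.+1.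
Proof.
elim: m k => [|m IHm] k /=.
  rewrite addn0 => kl; rewrite kl (ltnW kl); by case: k {kl} => [|k] /=; rewrite ?addn0.
case: k => [|k] /=; first by rewrite leq_add2r.
by rewrite addnS ltnS => /IHm; rewrite !addn0.
Qed.

Variable T : finType.
Implicit Types (V A : {set T}) (E : {set {set T}}).

Section Leaf.
Variables (V : {set T}) (E : {set {set T}}) (u v : T).
Hypotheses (EV : graph_on V E) (uV : u \in V) (vV : v \notin V).

Lemma ntrees_leaf_tip k :
  ntrees (v |: V) ([set u; v] |: E) [set v] k.+1 = ntrees V E [set u] k + (k == 0).
Proof.
by have := @ntrees_leaf _ V E u v EV uV vV set0 k; rewrite !setU0 inE eqxx andbT; apply.
Qed.

Lemma ntrees_leaf_all k :
  ntrees (v |: V) ([set u; v] |: E) set0 k.+1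
  = ntrees V E set0 k.+1 + (ntrees V E [set u] k + (k == 0)).
Proof. by rewrite ntrees_leafD ?inE // setU0 ntrees_leaf_tip. Qed.

Lemma ntrees_leaf_vertex w k : w \in V ->
  ntrees (v |: V) ([set u; v] |: E) [set w] k.+1
  = ntrees V E [set w] k.+1 + ntrees V E [set u; w] k.
Proof.
move=> wV; have vw : v \notin [set w] by rewrite inE; apply: contraNneq vV => ->.
rewrite ntrees_leafD // ntrees_leaf //.
have /negPf-> : [set w] != set0 by apply/set0Pn; exists w; rewrite inE.
by rewrite andbF addn0.
Qed.
End Leaf.

Variable c : seq T.
Hypotheses (Uc : uniq c) (c3 : 2 < size c) (cl : size c = l).

Let V0 := [set x in c].
Let E0 := cycle_edges c.

Lemma cycle_on : graph_on V0 E0.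
Proof.
move=> _ /imsetP[x xc ->]; apply/subsetP=> y.
by rewrite !inE => /orP[] /eqP->; rewrite ?mem_next.
Qed.

(** The bound at every single vertex is carried along because each step adds to the total the count
    at an arbitrary [u]. *)
Lemma grown_cycle_le m V E : grown V0 E0 m V E ->
  (forall w k, w \in V -> ntrees V E [set w] k <= star_count m k) /\
  (forall k, ntrees V E set0 k <= total_count star_count m k).
Proof.
elim=> [|{}m {}V {}E u v G [IHw IH] uV vV].
  split=> [w k | k]; last by rewrite ntrees_cycle // cl.
  by rewrite inE => wc; rewrite ntrees_cycle_vertex // cl.
have EV := grown_on G cycle_on.
split=> [w | ] [|k]; rewrite ?ntrees0 //=; last first.
  by rewrite ntrees_leaf_all // leq_add // leq_add2r IHw.
case/setU1P=> [-> | wV].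
  (* The correction [k == 0] is absorbed by [star_count m 1], which is positive. *)
  rewrite ntrees_leaf_tip // addnC leq_add ?IHw //.
  by case: k => //; apply: star_count1; rewrite -cl (ltnW (ltnW c3)).
rewrite ntrees_leaf_vertex // leq_add ?IHw //.
by apply: leq_trans (IHw w k wV); apply/ntreesS/subsetUr.
Qed.

(** A new vertex follows the path recursion with the bound at [u]. An old vertex keeps its earlier
    subtrees, which suffice by [path_count_le] as long as they fit into [V]. *)
Lemma grown_cycle_ge m V E : grown V0 E0 m V E ->
  (forall w k, w \in V -> path_count m k <= ntrees V E [set w] k) /\
  (forall k, total_count path_count m k <= ntrees V E set0 k).
Proof.
elim=> [|{}m {}V {}E u v G [IHw IH] uV vV].
  split=> [w k | k]; last by rewrite ntrees_cycle // cl.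
  by rewrite inE => wc; rewrite ntrees_cycle_vertex // cl.
have EV := grown_on G cycle_on.
have cV : #|V| = l + m by rewrite (grown_card G) cardsE (card_uniqP Uc) cl.
split=> [w | ] [|k]; rewrite ?ntrees0 //; last first.
  by rewrite ntrees_leaf_all //= leq_add // leq_add2r IHw.
case/setU1P=> [-> | wV]; first by rewrite ntrees_leaf_tip //= leq_add2r IHw.
rewrite ntrees_leaf_vertex //; case: (ltnP k (l + m)) => [klm | klm].
  by apply: leq_trans (path_count_le klm) (leq_trans (IHw _ _ wV) (leq_addr _ _)).
(* k >= |V|: a k-subtree spans V, hence contains u as well. *)
rewrite ntrees_large ?cV ?sub1set //= gtn_eqF; last first.
  by apply: leq_trans klm; rewrite -cl addn_gt0 (ltnW (ltnW c3)).
by rewrite addn0 (leq_trans (IHw _ _ wV)) ?leq_addl.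
Qed.
End Bounds.

(** * Building a graph on ['I_n] in layers over its cycle *)

Section Layers.
Variables (n l : nat) (e : rel 'I_n).
Hypotheses (hl : 2 < l) (hln : l <= n) (se : symmetric e).
Hypothesis e_cycle : forall x y : 'I_n, x < l -> y < l ->
  e x y = cyc_adj l x y || cyc_adj l y x.

(* US and UP are grown by adding the vertices l, l + 1, ... in this order. *)
Definition layer_verts j : {set 'I_n} := [set x : 'I_n | x < l + j].
Definition layer_edges j := [set f in edges e | f \subset layer_verts j].

Lemma layer_on j : graph_on (layer_verts j) (layer_edges j).
Proof. by move=> f; rewrite inE => /andP[]. Qed.

Lemma layer_last : layer_verts (n - l) = setT /\ layer_edges (n - l) = edges e.
Proof.
have VT : layer_verts (n - l) = setT by apply/setP=> x; rewrite !inE subnKC ?ltn_ord.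
by split=> //; apply/setP=> f; rewrite inE VT subsetT andbT.
Qed.

Lemma edges_pair (x y : 'I_n) : ([set x; y] \in edges e) = e x y.
Proof.
apply/imset2P/idP => [[a b _ + eqs] | exy]; last by exists x y; rewrite ?inE.
rewrite inE => /andP[_ eab].
have : a \in [set x; y] by rewrite eqs !inE eqxx.
have : b \in [set x; y] by rewrite eqs !inE eqxx orbT.
have : x \in [set a; b] by rewrite -eqs !inE eqxx.
have : y \in [set a; b] by rewrite -eqs !inE eqxx orbT.
rewrite !inE.
by do 4![case/orP=> /eqP ?]; subst; rewrite // se.
Qed.

(** List the vertices below [l] in increasing order: the cyclic successor is then x + 1 modulo [l],
    exactly the relation [cyc_adj]. *)
Lemma layer0_cycle : exists c : seq 'I_n,
  [/\ uniq c, size c = l, layer_verts 0 = [set x in c] & layer_edges 0 = cycle_edges c].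
Proof.
pose c := take l (enum 'I_n).
have cval : map val c = iota 0 l by rewrite map_take val_enum_ord take_iota (minn_idPl hln).
have memc x : (x \in c) = (x < l).
  by rewrite -(mem_map val_inj) cval mem_iota.
have Uc : uniq c by rewrite take_uniq ?enum_uniq.
have V0c : layer_verts 0 = [set x in c] by apply/setP=> x; rewrite !inE memc addn0.
have next_c x : x \in c -> val (next c x) = x.+1 %% l.
  pose r (a b : nat) := b == a.+1 %% l.
  have : cycle (relpre val r) c.
    rewrite -cycle_map cval.
    have iota_path k i : k + i < l -> path r k (iota k.+1 i).
      elim: i k => //= i IHi k; rewrite addnS -addSn => ki; rewrite IHi // andbT.
      by rewrite /r modn_small // (leq_ltn_trans (leq_addr i _)).
    have last_iota k i : last k (iota k.+1 i) = k + i.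
      by elim: i k => [|i IHi] k /=; rewrite ?addn0 // IHi addnS.
    have -> : iota 0 l = 0 :: iota 1 l.-1 by case: (l) hl.
    have l1 : l.-1.+1 = l by apply: prednK; apply: leq_trans hl.
    by rewrite /= rcons_path last_iota iota_path /r add0n l1 ?modnn.
  by move/next_cycle => nc /nc /eqP.
have cyc_next (x y : 'I_n) : x < l -> cyc_adj l x y -> y = next c x.
  move=> xl /and3P[_ _ /eqP yx]; apply/val_inj; rewrite next_c ?memc //.
have cyc_next' (x : 'I_n) : x < l -> cyc_adj l x (next c x).
  by move=> xl; rewrite /cyc_adj xl next_c ?memc // eqxx ltn_mod (leq_trans _ hl).
exists c; split=> //; first by rewrite -(size_map val) cval size_iota.
apply/setP=> f; rewrite inE; apply/andP/imsetP => [[/imset2P[x y _ + ->] + ] | [x xc ->]].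
  rewrite inE => /andP[_ exy] /subsetP fV.
  have := fV x; have := fV y; rewrite !inE !eqxx orbT addn0 => /(_ isT) yl /(_ isT) xl.
  move: exy; rewrite e_cycle // => /orP[] /cyc_next -> //.
    by exists x; rewrite ?memc.
  by exists y; rewrite ?memc // setUC.
rewrite memc in xc; rewrite edges_pair e_cycle //; last by rewrite -memc mem_next memc.
rewrite cyc_next' //; split=> //; apply/subsetP => y; rewrite V0c !inE.
by case/orP=> /eqP->; rewrite ?mem_next memc.
Qed.

(** Since [u] is the only earlier neighbour of [v] and [v] has no loop, uv is the only new edge. *)
Lemma layerS j (u v : 'I_n) : v = l + j :> nat ->
  {in layer_verts j, forall x, e x v = (x == u)} -> u \in layer_verts j -> e v v = false ->
  [/\ v \notin layer_verts j, layer_verts j.+1 = v |: layer_verts j &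
      layer_edges j.+1 = [set u; v] |: layer_edges j].
Proof.
move=> vE ev uV vv; have vV : v \notin layer_verts j by rewrite inE vE ltnn.
have VS : layer_verts j.+1 = v |: layer_verts j.
  by apply/setP=> x; rewrite !inE addnS ltnS leq_eqVlt -vE.
split=> //; apply/setP=> f; rewrite !inE; apply/andP/orP => [[fe fV] | [/eqP-> | /andP[fe fV]]].
- have [vf | vf] := boolP (v \in f); last first.
    right; rewrite fe; apply/subsetP=> x xf; have := subsetP fV x xf.
    by rewrite VS => /setU1P[xv | //]; rewrite -xv xf in vf.
  have [b fE ebv] : exists2 b, f = [set b; v] & e b v.
    have /imset2P[a b _ + fE] := fe; rewrite inE => /andP[_ eab].
    move: vf; rewrite fE !inE => /orP[] /eqP->; last by exists a.
    by exists b; rewrite 1?setUC // se.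
  have bV : b \in layer_verts j.
    have : b \in layer_verts j.+1 by apply: (subsetP fV); rewrite fE !inE eqxx.
    by rewrite VS => /setU1P[bv | //]; rewrite bv vv in ebv.
  by left; move: ebv; rewrite ev // fE => /eqP->.
- rewrite edges_pair ev // eqxx; split=> //; apply/subsetP=> x.
  by rewrite VS !inE => /orP[] /eqP->; rewrite ?eqxx //; move: uV; rewrite inE => ->; rewrite orbT.
- split=> //; apply: subset_trans fV _; rewrite VS; exact: subsetUr.
Qed.
End Layers.

(** * Exact counts for the two extremal graphs, and the comparison *)

Lemma cyc_adj_lt n l (x y : 'I_n) : cyc_adj l x y -> (x < l) && (y < l).
Proof. by case/and3P=> -> ->. Qed.

Lemma ntrees_US n l : 2 < l -> l <= n ->
  forall k, ntrees setT (edges (US n l)) set0 k = total_count l (star_count l) (n - l) k.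
Proof.
case: n => [|n] hl hln; first by move: (leq_trans hl hln).
have l0 : 0 < l by apply: leq_trans hl.
have se : symmetric (US n.+1 l) by move=> x y; rewrite /US orbC.
have e_cycle (x y : 'I_n.+1) : x < l -> y < l ->
    US n.+1 l x y = cyc_adj l x y || cyc_adj l y x.
  by move=> xl yl; rewrite /US /US_base [l <= y]leqNgt [l <= x]leqNgt xl yl !andbF !orbF.
have nc (v x : 'I_n.+1) : l <= v -> (cyc_adj l x v = false) * (cyc_adj l v x = false).
  by move=> lv; split; apply/negP => /cyc_adj_lt/andP[+ +]; rewrite ![v < l]ltnNge lv /=.
have [c [Uc cl Vc Ec]] := layer0_cycle hl hln se e_cycle.
(* The total at the next stage needs the count at the attachment vertex 0, so both are computed
   together. *)
suff IH j : j <= n.+1 - l -> forall k,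
    ntrees (layer_verts n.+1 l j) (layer_edges l (US n.+1 l) j) [set ord0] k
      = star_count l j k /\
    ntrees (layer_verts n.+1 l j) (layer_edges l (US n.+1 l) j) set0 k
      = total_count l (star_count l) j k.
  by move=> k; have [<- <-] := layer_last (US n.+1 l) hln; case: (IH _ (leqnn _) k).
elim: j => [|j IHj] jn k.
  have o0c : ord0 \in c by move/setP/(_ ord0): Vc; rewrite !inE addn0 l0.
  by rewrite Vc Ec ntrees_cycle ?ntrees_cycle_vertex ?cl.
have vn : l + j < n.+1 by rewrite -ltn_subRL.
have [v vE] : exists v : 'I_n.+1, v = l + j :> nat by exists (Ordinal vn).
have lv : l <= v by rewrite vE leq_addr.
have o0V : ord0 \in layer_verts n.+1 l j by rewrite inE ltn_addr.
have v0 : ((v : nat) == 0) = false by rewrite gtn_eqF // (leq_trans l0).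
have [|||vV -> ->] // := @layerS n.+1 l (US n.+1 l) se j ord0 v vE.
- by move=> x _; rewrite /US /US_base !(nc v) // lv v0 /= andbT orbF.
- by rewrite /US /US_base !(nc v) // v0.
case: k => [|k]; first by rewrite !ntrees0.
have [IHs IHt] := (fun k => proj1 (IHj (ltnW jn) k), fun k => proj2 (IHj (ltnW jn) k)).
have on := @layer_on n.+1 l (US n.+1 l) j.
(* Attachment vertex and counted vertex coincide, so the trees through both are those through 0, and
   the star recursion holds with equality. *)
by rewrite ntrees_leaf_vertex ?ntrees_leaf_all // setUid !IHs !IHt.
Qed.

Lemma ntrees_UP n l : 2 < l -> l <= n ->
  forall k, ntrees setT (edges (UP n l)) set0 k = total_count l (path_count l) (n - l) k.
Proof.
case: n => [|n] hl hln; first by move: (leq_trans hl hln).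
have l0 : 0 < l by apply: leq_trans hl.
have se : symmetric (UP n.+1 l) by move=> x y; rewrite /UP orbC.
have e_cycle (x y : 'I_n.+1) : x < l -> y < l ->
    UP n.+1 l x y = cyc_adj l x y || cyc_adj l y x.
  by move=> xl yl; rewrite /UP /UP_base [l <= y]leqNgt [l <= x]leqNgt xl yl !orbF.
have nc (v x : 'I_n.+1) : l <= v -> (cyc_adj l x v = false) * (cyc_adj l v x = false).
  by move=> lv; split; apply/negP => /cyc_adj_lt/andP[+ +]; rewrite ![v < l]ltnNge lv /=.
have [c [Uc cl Vc Ec]] := layer0_cycle hl hln se e_cycle.
(* The free end after j additions. For j = 0 it is 0, where the path is attached, and not l - 1. *)
pose tip j := if j == 0 then 0 else (l + j).-1.
have tip_lt j : tip j < l + j.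
  by rewrite /tip; case: j => [|j] /=; rewrite ?addn0 // addnS.
suff IH j : j <= n.+1 - l -> forall k,
    (forall w : 'I_n.+1, w = tip j :> nat ->
    ntrees (layer_verts n.+1 l j) (layer_edges l (UP n.+1 l) j) [set w] k
      = path_count l j k) /\
    ntrees (layer_verts n.+1 l j) (layer_edges l (UP n.+1 l) j) set0 k
      = total_count l (path_count l) j k.
  by move=> k; have [<- <-] := layer_last (UP n.+1 l) hln; case: (IH _ (leqnn _) k).
elim: j => [|j IHj] jn k.
  split=> [w w0|]; last by rewrite Vc Ec ntrees_cycle ?cl.
  have wc : w \in c by move/setP/(_ w): Vc; rewrite !inE addn0 w0 l0.
  by rewrite Vc Ec ntrees_cycle_vertex ?cl.
have vn : l + j < n.+1 by rewrite -ltn_subRL.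
have [v vE] : exists v : 'I_n.+1, v = l + j :> nat by exists (Ordinal vn).
have lv : l <= v by rewrite vE leq_addr.
pose u := Ordinal (ltn_trans (tip_lt j) vn).
have uV : u \in layer_verts n.+1 l j by rewrite inE /= tip_lt.
have tipE : (if (v : nat) == l then 0 else v.-1) = tip j.
  by rewrite vE -{2}(addn0 l) eqn_add2l.
have [|||vV -> ->] // := @layerS n.+1 l (UP n.+1 l) se j u v vE.
- move=> x; rewrite inE => xv; rewrite /UP /UP_base !(nc v) // lv tipE /=.
  (* [v] cannot precede [x] on the path, since [x] belongs to an earlier layer. *)
  rewrite (_ : (l <= x) && _ = false) ?orbF //; apply/negP => /andP[lx].
  case: ifP => _ /eqP vE'; move: xv lx; [|].
    by rewrite leqNgt vE' l0 in lv.
  by rewrite -vE vE'; case: (val x) => //= x' ; rewrite ltnNge leqW.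
- rewrite /UP /UP_base !(nc v) // lv tipE /= orbb.
  by rewrite vE gtn_eqF.
case: k => [|k]; first by split=> [w _|]; rewrite !ntrees0.
have [IHs IHt] := (fun k => proj1 (IHj (ltnW jn) k), fun k => proj2 (IHj (ltnW jn) k)).
have on := @layer_on n.+1 l (UP n.+1 l) j.
split=> [w wE|]; last by rewrite ntrees_leaf_all // IHt IHs.
have -> : w = v by apply/val_inj; rewrite /= wE vE /tip addnS.
by rewrite ntrees_leaf_tip // IHs.
Qed.

Theorem theorem10 (n l : nat) (hl : 3 <= l) (hln : l <= n) (e : rel 'I_n) :
  simple_graph e -> unicyclic e -> girth_is e l ->
  forall k : nat, nsub (US n l) k >= nsub e k /\ nsub e k >= nsub (UP n l) k.
Proof.
move=> se ue ge k.
have x0 : 'I_n by exists 0; apply: leq_trans hln; apply: leq_trans hl.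
have [c [m [Uc c3 cl G]]] := unicyclic_grown x0 se ue ge.
(* Each attachment adds one vertex to the [l] vertices of the cycle, so counting vertices fixes
   their number. *)
have mE : m = n - l.
  by have := grown_card G; rewrite cardsT card_ord cardsE (card_uniqP Uc) cl => ->; rewrite addKn.
rewrite !ntrees_nsub; case: eqP => // _.
rewrite ntrees_US // ntrees_UP // -mE.
by split; [apply: (proj2 (grown_cycle_le Uc c3 cl G)) | apply: (proj2 (grown_cycle_ge Uc c3 cl G))].
Qed.
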